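(* Let $T>0$ and let $f\colon[0,T]\to\mathbb R$ and $u\colon\mathbb R\to\mathbb R$ be measurable functions. Consider the equation $$X_t=\int_0^tu(X_s)\,ds+f(t),\quad t\in[0,T],\qquad X|_{t=0}=X_0\in\mathbb R$$ (so that $X_0=f(0)$). Let either of the following two groups of conditions hold. (D1) 1) $u$ is Lipschitz: there exists $C>0$ such that $|u(x)-u(y)|\le C|x-y|$ for any $x,y\in\mathbb R$; 2) $f$ is locally integrable. (D2) 1) $u$ is of linear growth: there exists $C>0$ such that $|u(x)|\le C(1+|x|)$ for any $x\in\mathbb R$; 2) $u$ is locally Lipschitz: for any $R>0$ there exists $C_R>0$ such that $|u(x)-u(y)|\le C_R|x-y|$ for any $x,y\in\mathbb R$ with $|x|,|y|<R$; 3) $f$ is locally bounded. Then the equation has a unique solution $X$ on $[0,T]$. If (D1) holds, then $X$ is locally integrable. If (D2) holds, then $X$ is locally bounded.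
   Context: A solution is a measurable function $X\colon[0,T]\to\mathbb R$ with $s\mapsto u(X_s)$ integrable on $[0,T]$ satisfying the integral equation for all $t\in[0,T]$. ''Locally integrable'' and ''locally bounded'' here mean integrable, respectively bounded, on $[0,T]$. *)

(* Defs.v *)
From HB Require Import structures.
From mathcomp Require Import all_boot all_order all_algebra.
From mathcomp Require Import all_classical all_reals all_analysis.

Set Implicit Arguments.
Unset Strict Implicit.
Unset Printing Implicit Defensive.

Import Order.TTheory GRing.Theory Num.Theory.
Import numFieldNormedType.Exports.

Local Open Scope classical_set_scope.
Local Open Scope ring_scope.

(* Functions on [0, T] are represented by total functions R -> R of which only
   the values on `[0, T] are ever used; they are considered equal when they
   agree at every point of `[0, T].  Measurability is Borel measurability. *)

Definition integrable_on (R : realType) (T : R) (g : R -> R) : Prop :=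
  (@lebesgue_measure R).-integrable `[0, T] (EFin \o g).

Definition bounded_on_itv (R : realType) (T : R) (g : R -> R) : Prop :=
  [bounded g t | t in `[0, T]].

Definition lipschitz_fun (R : realType) (u : R -> R) : Prop :=
  exists C : R, 0 < C /\ forall x y : R, `|u x - u y| <= C * `|x - y|.

Definition linear_growth (R : realType) (u : R -> R) : Prop :=
  exists C : R, 0 < C /\ forall x : R, `|u x| <= C * (1 + `|x|).

Definition locally_lipschitz_fun (R : realType) (u : R -> R) : Prop :=
  forall r : R, 0 < r -> exists C : R, 0 < C /\
    forall x y : R, `|x| < r -> `|y| < r -> `|u x - u y| <= C * `|x - y|.

Definition condD1 (R : realType) (T : R) (f u : R -> R) : Prop :=
  lipschitz_fun u /\ integrable_on T f.

Definition condD2 (R : realType) (T : R) (f u : R -> R) : Prop :=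
  [/\ linear_growth u, locally_lipschitz_fun u & bounded_on_itv T f].

(* [Rintegral] is total, so the integrability of s |-> u (X s) is part of the
   notion of solution. *)
Definition is_solution (R : realType) (T : R) (f u : R -> R) (X0 : R)
    (X : R -> R) : Prop :=
  [/\ measurable_fun `[0, T] X,
      integrable_on T (u \o X),
      forall t : R, t \in `[0, T] ->
        X t = Rintegral (@lebesgue_measure R) `[0, t] (u \o X) + f t
    & X 0 = X0].

(* Main.v *)
Require Import Defs.
From HB Require Import structures.
From mathcomp Require Import all_boot all_order all_algebra.
From mathcomp Require Import all_classical all_reals all_analysis.
From mathcomp Require Import measurable_realfun ring lra.

(* With the weight w(t) = exp(2Ct), integration on [0, t] turns a bound
   |g| <= C m w into |int g| <= (m / 2) w.  In the weighted sup norm the Picard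
   map is therefore a 1/2-contraction when u is C-Lipschitz, without splitting
   [0, T] into small intervals, and the same estimate gives Gronwall's
   inequality.  Since X - f is an integral over [0, t], it is bounded for every
   solution X, so X is as integrable or bounded as f.  Under (D2), u is replaced
   by its composition with the truncation to [-r, r], with r the a priori bound,
   which depends only on T, sup |f| and the linear growth constant of u, and
   truncation does not increase the latter. *)

Set Implicit Arguments.
Unset Strict Implicit.
Unset Printing Implicit Defensive.

Import Order.TTheory GRing.Theory Num.Theory.
Import numFieldNormedType.Exports.

Local Open Scope classical_set_scope.
Local Open Scope ring_scope.

(** * Bounded functions and geometrically convergent real sequences *)

Lemma bounded_on_itvP (R : realType) (T : R) (g : R -> R) :
  bounded_on_itv T g <-> exists M : R, forall t, t \in `[0, T] -> `|g t| <= M.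
Proof.
split=> [[M [_ Mg]]|[M Mg]].
  by exists (M + 1) => t tT; apply: (Mg (M + 1)) => //; rewrite ltrDl.
exists M; split; first exact: num_real.
by move=> N MN t tT; apply: le_trans (ltW MN); exact: Mg.
Qed.

Lemma le0_of_geometric (R : realType) (x K : R) :
  (forall n, x <= K * 2^-1 ^+ n) -> x <= 0.
Proof.
move=> xK; have K0 : geometric K 2^-1 @ \oo --> (0 : R).
  by apply: cvg_geometric; rewrite ger0_norm//; lra.
have cx : (fun=> x) @ \oo --> x by exact: cvg_cst.
by apply: (ler_cvg_to cx K0); near=> n; exact: xK.
Unshelve. all: by end_near.
Qed.

Lemma cvg_geometric_steps (R : realType) (a : R^nat) (K : R) :
  (forall n, `|a n.+1 - a n| <= K * 2^-1 ^+ n) ->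
  a @ \oo --> lim (a @ \oo) /\
  forall n, `|a n - lim (a @ \oo)| <= 2 * K * 2^-1 ^+ n.
Proof.
move=> aK.
(* [b] increases, [c] decreases and [b <= c], so [sup b] lies between them. *)
pose b n := a n - 2 * K * 2^-1 ^+ n; pose c n := a n + 2 * K * 2^-1 ^+ n.
have K0 : 0 <= K by have := le_trans (normr_ge0 _) (aK 0%N); rewrite expr0 mulr1.
(* From [n] to [n.+1] the shift [2 * K * 2^-1 ^+ n] shrinks by exactly [K * 2^-1 ^+ n], which
   compensates the largest possible step of [a]. *)
have bnd : {homo b : m n / (m <= n)%N >-> m <= n}.
  apply/nondecreasing_seqP => n; rewrite /b exprS; have := aK n.
  by rewrite ler_norml => /andP[+ _]; set y := _ ^+ n; lra.
have cni : {homo c : m n / (m <= n)%N >-> n <= m}.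
  apply/nonincreasing_seqP => n; rewrite /c exprS; have := aK n.
  by rewrite ler_norml => /andP[_]; set y := _ ^+ n; lra.
have pow0 n : 0 <= 2 * K * 2^-1 ^+ n :> R by rewrite !mulr_ge0// exprn_ge0.
have bc m n : b m <= c n.
  rewrite (le_trans (bnd _ _ (leq_maxl m n)))//.
  apply: le_trans (cni _ _ (leq_maxr m n)).
  by have := pow0 (maxn m n); rewrite /b /c; set y := _ * _ ^+ _; lra.
pose l := sup (range b).
have bl n : b n <= l.
  by apply: ub_le_sup; [exists (c 0%N) => _ [m _ <-]|exists n].
have lc n : l <= c n.
  by apply: ge_sup; [exists (b 0%N), 0%N|move=> _ [m _ <-]].
have al n : `|a n - l| <= 2 * K * 2^-1 ^+ n.
  rewrite ler_norml; have := bl n; have := lc n; rewrite /b /c.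
  by move: (2 * K * _) => y; lra.
have cal : a @ \oo --> l.
  have : geometric (2 * K) 2^-1 @ \oo --> (0 : R).
    by apply: cvg_geometric; rewrite ger0_norm//; lra.
  move=> /cvgrPdist_le geo; apply/cvgrPdist_le => e /geo; apply: filterS => n.
  by rewrite sub0r normrN distrC /= ger0_norm//; apply: le_trans; exact: al.
by have /cvg_lim -> := cal.
Qed.

(** * Exponentially weighted integral estimates and Gronwall's inequality *)

Lemma Rintegral_expR_le (R : realType) (k t : R) : 0 < k -> 0 <= t ->
  \int[lebesgue_measure]_(s in `[0, t]) expR (k * s) <= k^-1 * expR (k * t).
Proof.
(* The fundamental theorem of calculus is applied on a nondegenerate interval, so [t = 0] is split
   off. *)
move=> k0; rewrite le_eqVlt => /predU1P[<-|t0].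
  by rewrite set_itv1 Rintegral_set1 mulr_ge0 ?expR_ge0// invr_ge0 ltW.
have dF (x : R) : is_derive x 1 (fun y : R => k^-1 * expR (k * y)) (expR (k * x)).
  apply: is_derive_eq.
  by rewrite /GRing.scale/= mulr1 mulrCA mulVf ?mulr1// gt_eqF.
have cF : continuous (fun y : R => k^-1 * expR (k * y)).
  move=> x; apply: differentiable_continuous; apply/derivable1_diffP.
  exact: ex_derive.
rewrite /Rintegral (@continuous_FTC2 _ _ (fun y => k^-1 * expR (k * y)))//=.
- by rewrite lerBlDr lerDl mulr_ge0 ?expR_ge0// invr_ge0 ltW.
- apply: continuous_subspaceT => x.
  by apply: continuous_comp; [exact: mulrl_continuous|exact: continuous_expR].
- split => [x _||]; first exact: ex_derive.
  + by apply: cvg_at_right_filter; exact: cF.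
  + by apply: cvg_at_left_filter; exact: cF.
- by move=> x _; rewrite derive1E; exact: derive_val.
Qed.

Lemma norm_Rintegral_weighted_le (R : realType) (T C m t : R) (g : R -> R) :
  0 < C -> 0 <= m -> t \in `[0, T] -> integrable_on T g ->
  (forall s, s \in `[0, T] -> `|g s| <= C * (m * expR (2 * C * s))) ->
  `|\int[lebesgue_measure]_(s in `[0, t]) g s| <= m / 2 * expR (2 * C * t).
Proof.
move=> C0 m0 tT ig gle.
have /andP[t0 tleT] : 0 <= t <= T by move: tT; rewrite in_itv.
have st : (`[0, t] `<=` `[0, T])%classic.
  by move=> s /=; rewrite !in_itv/= => /andP[-> /le_trans->].
have ig' : lebesgue_measure.-integrable `[0, t] (EFin \o g).
  by apply: integrableS ig.
have iexp : lebesgue_measure.-integrable `[0, t]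
    (EFin \o (fun s => expR (2 * C * s))).
  apply: continuous_compact_integrable; first exact: segment_compact.
  apply: continuous_subspaceT => x.
  by apply: continuous_comp; [exact: mulrl_continuous|exact: continuous_expR].
apply: (le_trans (le_normr_Rintegral _ ig')) => //.
apply: (@le_trans _ _
    (\int[lebesgue_measure]_(s in `[0, t]) (C * m * expR (2 * C * s)))).
  apply: le_Rintegral => //.
  - exact: integrable_norm.
  - by have := integrableZl _ (C * m) iexp; apply.
  - by move=> s /st sT; rewrite -mulrA; exact: gle.
rewrite RintegralZl//.
have := @Rintegral_expR_le R (2 * C) t.
rewrite mulr_gt0// => /(_ isT t0) le_exp.
apply: le_trans (ler_wpM2l _ le_exp) _; first by rewrite mulr_ge0// ltW.
by rewrite le_eqVlt; apply/orP; left; apply/eqP; field; lra.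
Qed.

(** Let [m] be the supremum of [h] divided by the weight, finite thanks to [B]. The weighted
    estimate turns the integral inequality into [m <= A + m / 2], so [m <= 2 * A], whatever the
    value of [B]. *)
Lemma gronwall (R : realType) (T A C B : R) (g h : R -> R) :
  0 < T -> 0 < C -> integrable_on T g ->
  (forall t, t \in `[0, T] -> h t <= B) ->
  (forall t, t \in `[0, T] -> `|g t| <= C * h t) ->
  (forall t, t \in `[0, T] ->
    h t <= A + `|\int[lebesgue_measure]_(s in `[0, t]) g s|) ->
  forall t, t \in `[0, T] -> h t <= 2 * A * expR (2 * C * t).
Proof.
move=> T0 C0 ig hB gh hA.
have zT : 0 \in `[0, T] by rewrite in_itv/= lexx ltW.
have h0 t : t \in `[0, T] -> 0 <= h t.
  by move=> /gh /(le_trans (normr_ge0 _)); rewrite pmulr_rge0.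
pose E := [set h t * expR (- (2 * C * t)) | t in `[0, T]].
have hE t : t \in `[0, T] -> E (h t * expR (- (2 * C * t))) by exists t.
have ubE : has_ubound E.
  exists B => _ [t tT <-]; rewrite -[leRHS]mulr1 ler_pM ?h0 ?expR_ge0 ?hB//.
  rewrite -expR0 ler_expR oppr_le0; move: tT; rewrite /= in_itv/= => /andP[t0 _].
  by rewrite !mulr_ge0// ltW.
pose m := sup E.
have hm t : t \in `[0, T] -> h t <= m * expR (2 * C * t).
  by move=> /hE Eh; rewrite -ler_pdivrMr ?expR_gt0// -expRN ub_le_sup.
have m0 : 0 <= m.
  have := ub_le_sup ubE (hE _ zT); apply: le_trans.
  by rewrite mulr_ge0 ?expR_ge0 ?h0.
(* At [t = 0] the integral vanishes, leaving [0 <= h 0 <= A]. *)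
have A0 : 0 <= A.
  have := hA _ zT; rewrite set_itv1 Rintegral_set1 normr0 addr0.
  by apply: le_trans; exact: h0.
have mA : m <= A + m / 2.
  apply: ge_sup; first by exists (h 0 * expR (- (2 * C * 0))); exact: hE.
  move=> _ [t tT <-]; rewrite expRN ler_pdivrMr ?expR_gt0//.
  apply: (le_trans (hA _ tT)); rewrite mulrDl lerD//.
    rewrite ler_peMr// -expR0 ler_expR.
    by move: tT; rewrite /= in_itv/= => /andP[t0 _]; rewrite !mulr_ge0// ltW.
  apply: (norm_Rintegral_weighted_le C0 m0 tT ig) => s sT.
  by rewrite (le_trans (gh _ sT))// ler_wpM2l ?hm// ltW.
move=> t tT; rewrite (le_trans (hm _ tT))// ler_wpM2r ?expR_ge0//; lra.
Qed.

(** * Indefinite integrals, and integrability of compositions with [u] *)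

Lemma within_itv_continuous_Rintegral (R : realType) (T : R) (g : R -> R) :
  0 < T -> integrable_on T g ->
  {within `[0, T], continuous
    (fun t => \int[lebesgue_measure]_(s in `[0, t]) g s)}.
Proof. by move=> /ltW T0; exact: parameterized_integral_continuous. Qed.

Lemma measurable_Rintegral_itv (R : realType) (T : R) (g : R -> R) :
  0 < T -> integrable_on T g ->
  measurable_fun `[0, T]
    (fun t => \int[lebesgue_measure]_(s in `[0, t]) g s).
Proof.
move=> T0 ig; apply: subspace_continuous_measurable_fun => //.
exact: within_itv_continuous_Rintegral.
Qed.

Lemma bounded_Rintegral_itv (R : realType) (T : R) (g : R -> R) :
  0 < T -> integrable_on T g ->
  bounded_on_itv T (fun t => \int[lebesgue_measure]_(s in `[0, t]) g s).
Proof.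
move=> T0 ig; have /continuous_compact := within_itv_continuous_Rintegral T0 ig.
move=> /(_ (@segment_compact _ _ _)) /compact_bounded [M [Mr MP]].
exists M; split => // N MN t tT; apply: (MP N MN); by exists t.
Qed.

Lemma bounded_on_itvD (R : realType) (T : R) (g h : R -> R) :
  bounded_on_itv T g -> bounded_on_itv T h ->
  bounded_on_itv T (fun t => g t + h t).
Proof.
move=> /bounded_on_itvP[M gM] /bounded_on_itvP[N hN].
apply/bounded_on_itvP; exists (M + N) => t tT.
by rewrite (le_trans (ler_normD _ _))// lerD ?gM ?hN.
Qed.

Lemma bounded_integrable_on (R : realType) (T : R) (g : R -> R) :
  measurable_fun `[0, T] g -> bounded_on_itv T g -> integrable_on T g.
Proof.
move=> mg bg; apply: measurable_bounded_integrable => //.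
exact: compact_finite_measure (@segment_compact _ _ _).
Qed.

(** The difference of the two compositions is bounded, hence integrable on a set of finite measure.
    This carries integrability from [f] to the Picard iterates and to their limit. *)
Lemma integrable_on_comp_close (R : realType) (T C : R) (u X Y : R -> R) :
  0 < C -> (forall x y, `|u x - u y| <= C * `|x - y|) ->
  measurable_fun [set: R] u ->
  measurable_fun `[0, T] X -> measurable_fun `[0, T] Y ->
  bounded_on_itv T (fun t => Y t - X t) ->
  integrable_on T (u \o X) -> integrable_on T (u \o Y).
Proof.
move=> C0 uC meas_u mX mY /bounded_on_itvP[M YX] iX.
have mD : measurable_fun `[0, T] (fun t => u (Y t) - u (X t)).
  by apply: measurable_funB; exact: measurableT_comp.
have iD : integrable_on T (fun t => u (Y t) - u (X t)).
  apply: bounded_integrable_on => //; apply/bounded_on_itvP.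
  by exists (C * M) => t tT; rewrite (le_trans (uC _ _))// ler_wpM2l ?YX// ltW.
have uYE : EFin \o (u \o Y) =
    (EFin \o (fun t => u (Y t) - u (X t))) \+ (EFin \o (u \o X)) :> (R -> \bar R).
  by apply/funext => t /=; rewrite -EFinD subrK.
by rewrite /integrable_on uYE; exact: integrableD.
Qed.

(** The composition is dominated by the integrable function [|u 0| + C * |f|]. *)
Lemma integrable_on_comp_lipschitz (R : realType) (T C : R) (u f : R -> R) :
  0 < C -> (forall x y, `|u x - u y| <= C * `|x - y|) ->
  measurable_fun [set: R] u ->
  measurable_fun `[0, T] f -> integrable_on T f -> integrable_on T (u \o f).
Proof.
move=> C0 uC meas_u mf intf.
have ic : integrable_on T (cst `|u 0|).
  apply: bounded_integrable_on; first exact: measurable_cst.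
  by apply/bounded_on_itvP; exists `|u 0| => t _; rewrite normr_id.
have iCf : integrable_on T (fun t => C * `|f t|).
  by have := integrableZl _ C (integrable_norm intf); apply.
apply: (le_integrable _ _ _ (integrableD _ ic iCf)) => //.
  by apply/measurable_EFinP; exact: measurableT_comp.
move=> t tT /=; rewrite lee_fin [leRHS]ger0_norm; last first.
  by rewrite addr_ge0// mulr_ge0// ltW.
rewrite -(subrK (u 0) (u (f t))) (le_trans (ler_normD _ _))//.
by rewrite [leRHS]addrC lerD// (le_trans (uC _ _))// subr0.
Qed.

(** * Picard iteration for a Lipschitz coefficient *)

Definition volterra (R : realType) (f u X : R -> R) (t : R) : R :=
  \int[lebesgue_measure]_(s in `[0, t]) u (X s) + f t.

(* The class of functions preserved by the Picard map when u is Lipschitz; f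
   itself may be unbounded. *)
Definition admissible (R : realType) (T : R) (f u X : R -> R) : Prop :=
  [/\ measurable_fun `[0, T] X, integrable_on T (u \o X)
    & bounded_on_itv T (fun t => X t - f t)].

(** The image minus [f] is an indefinite integral, hence bounded. So [X] and its image both stay at
    bounded distance from [f], thus from each other, and integrability transfers. *)
Lemma admissible_volterra (R : realType) (T C : R) (f u X : R -> R) :
  0 < T -> 0 < C -> (forall x y, `|u x - u y| <= C * `|x - y|) ->
  measurable_fun [set: R] u -> measurable_fun `[0, T] f ->
  admissible T f u X -> admissible T f u (volterra f u X).
Proof.
move=> T0 C0 uC meas_u mf [mX iX bX].
have mV : measurable_fun `[0, T] (volterra f u X).
  by apply: measurable_funD => //; exact: measurable_Rintegral_itv iX.
have bV : bounded_on_itv T (fun t => volterra f u X t - f t).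
  rewrite /volterra; under eq_fun do rewrite addrK.
  exact: bounded_Rintegral_itv iX.
split=> //; apply: (integrable_on_comp_close C0 uC meas_u mX mV _ iX).
have [M bXM] := (bounded_on_itvP _ _).1 bX.
have [N bVN] := (bounded_on_itvP _ _).1 bV.
apply/bounded_on_itvP; exists (N + M) => t tT.
rewrite -(subrKA (f t)) (le_trans (ler_normD _ _))// lerD ?bVN//.
by rewrite distrC bXM.
Qed.

(** The contraction is phrased with pointwise bounds, so that no function space with a weighted norm
    has to be set up. *)
Lemma volterra_contraction (R : realType) (T C m : R) (f u X Y : R -> R) :
  0 < C -> (forall x y, `|u x - u y| <= C * `|x - y|) -> 0 <= m ->
  integrable_on T (u \o X) -> integrable_on T (u \o Y) ->
  (forall t, t \in `[0, T] -> `|X t - Y t| <= m * expR (2 * C * t)) ->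
  forall t, t \in `[0, T] ->
    `|volterra f u X t - volterra f u Y t| <= m / 2 * expR (2 * C * t).
Proof.
move=> C0 uC m0 iX iY XY t tT.
have st : (`[0, t] `<=` `[0, T])%classic.
  move: tT => /itvP tT s /=; rewrite !in_itv/= => /andP[-> /le_trans->]//.
  by rewrite tT.
rewrite /volterra opprD addrACA subrr addr0 -RintegralB//; last 2 first.
- exact: integrableS iX.
- exact: integrableS iY.
apply: (norm_Rintegral_weighted_le C0 m0 tT).
  have := integrableB _ iX iY; rewrite /integrable_on.
  by apply.
by move=> s sT; rewrite (le_trans (uC _ _))// ler_wpM2l ?XY// ltW.
Qed.

Lemma lipschitz_solution (R : realType) (T : R) (f u : R -> R) :
  0 < T -> measurable_fun (`[0, T] : set R) f -> measurable_fun [set: R] u ->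
  condD1 T f u -> exists X, is_solution T f u (f 0) X.
Proof.
move=> T0 mf meas_u [[C [C0 uC]] intf].
(* The iteration starts at [f] itself, which is trivially at bounded distance from [f] even when [f]
   is unbounded. *)
pose V := volterra f u; pose x n := iter n V f; pose w t := expR (2 * C * t).
have w1 t : t \in `[0, T] -> 1 <= w t.
  by move=> /itvP tT; rewrite -expR0 ler_expR !mulr_ge0 ?tT// ltW.
have wT t : t \in `[0, T] -> w t <= w T.
  by move=> /itvP tT; rewrite ler_expR ler_wpM2l ?tT// mulr_ge0// ltW.
have adm_f : admissible T f u f.
  split => //.
    exact: integrable_on_comp_lipschitz C0 uC meas_u mf intf.
  by apply/bounded_on_itvP; exists 0 => t _; rewrite subrr normr0.
have adm n : admissible T f u (x n).
  by elim: n => // n IHn; exact: (admissible_volterra T0 C0 uC).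
have [M M0 x01] : exists2 M, 0 <= M &
    forall t, t \in `[0, T] -> `|x 1%N t - x 0%N t| <= M.
  have [_ _ /bounded_on_itvP[M xM]] := adm 1%N.
  exists M => //; apply: (le_trans _ (xM 0 _)) => //.
  by rewrite in_itv/= lexx ltW.
have step n t : t \in `[0, T] ->
    `|x n.+1 t - x n t| <= M * 2^-1 ^+ n * w t.
  elim: n t => [|n IHn] t tT.
    by rewrite expr0 mulr1 (le_trans (x01 _ tT))// ler_peMr// w1.
  rewrite exprSr mulrA; apply: volterra_contraction tT => //.
  - by rewrite mulr_ge0// exprn_ge0.
  - by have [] := adm n.+1.
  - by have [] := adm n.
pose X t := lim (x ^~ t @ \oo).
have lim_x t : t \in `[0, T] -> x ^~ t @ \oo --> X t /\
    forall n, `|x n t - X t| <= 2 * (M * w t) * 2^-1 ^+ n.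
  by move=> tT; apply: cvg_geometric_steps => n; rewrite mulrAC step.
have mX : measurable_fun `[0, T] X.
  apply: (@measurable_fun_cvg _ _ _ _ x) => [n|t tT]; first by have [] := adm n.
  by have [] := lim_x t tT.
have intuX : integrable_on T (u \o X).
  have [_ intuf _] := adm_f.
  (* The rate of convergence at [n = 0] bounds [X - f], as [x 0] is [f]. *)
  apply: (integrable_on_comp_close C0 uC meas_u mf mX _ intuf).
  apply/bounded_on_itvP; exists (2 * (M * w T)) => t tT.
  rewrite distrC; have [_ /(_ 0%N)] := lim_x t tT; rewrite expr0 mulr1.
  by move=> /le_trans; apply; rewrite ler_wpM2l// ler_wpM2l// wT.
(* Compare both sides with [x n.+1 t]: its distances to [X t] (rate of convergence) and to [V X t]
   (contraction applied to [x n] and [X]) are each at most [M * w t * 2^-1 ^+ n]. No limit is taken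
   under the integral. *)
have XE t : t \in `[0, T] -> X t = V X t.
  move=> tT; apply/eqP; rewrite -subr_eq0 -normr_le0.
  apply: (@le0_of_geometric _ _ (2 * (M * w t))) => n.
  have [_ intxn _] := adm n.
  have m0 : 0 <= 2 * M * 2^-1 ^+ n by rewrite !mulr_ge0// exprn_ge0.
  have VxV : `|x n.+1 t - V X t| <= 2 * M * 2^-1 ^+ n / 2 * w t.
    apply: volterra_contraction tT => // s sT.
    have [_ /(_ n)] := lim_x s sT; rewrite -/(w s).
    by move=> /le_trans; apply; rewrite le_eqVlt mulrA mulrAC eqxx.
  have [_ /(_ n.+1)] := lim_x t tT; rewrite distrC exprS => xX.
  rewrite -(subrKA (x n.+1 t)) (le_trans (ler_normD _ _))//.
  rewrite (le_trans (lerD xX VxV))//.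
  by rewrite le_eqVlt; apply/orP; left; apply/eqP; field.
exists X; split => //.
rewrite XE ?in_itv/= ?lexx ?ltW//.
by rewrite /V /volterra set_itv1 Rintegral_set1 add0r.
Qed.

(** * Uniqueness of solutions *)

Lemma solution_admissible (R : realType) (T X0 : R) (f u X : R -> R) :
  0 < T -> is_solution T f u X0 X -> admissible T f u X.
Proof.
move=> T0 [mX iX XE _]; split => //.
have /bounded_on_itvP[M bM] := bounded_Rintegral_itv T0 iX.
by apply/bounded_on_itvP; exists M => t tT; rewrite XE// addrK bM.
Qed.

(** Gronwall's inequality with [A = 0] for [|X - Y|], which is bounded because [X - f] and [Y - f]
    are. The Lipschitz bound is asked only along the two solutions, so that it covers both (D1) and
    (D2). *)
Lemma solution_unique_of_lipschitz (R : realType) (T C X0 : R)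
    (f u X Y : R -> R) :
  0 < T -> 0 < C -> is_solution T f u X0 X -> is_solution T f u X0 Y ->
  (forall t, t \in `[0, T] -> `|u (X t) - u (Y t)| <= C * `|X t - Y t|) ->
  forall t, t \in `[0, T] -> X t = Y t.
Proof.
move=> T0 C0 sX sY uC t tT.
have [_ iX /bounded_on_itvP[M XM]] := solution_admissible T0 sX.
have [_ iY /bounded_on_itvP[N YN]] := solution_admissible T0 sY.
have [_ _ XE _] := sX; have [_ _ YE _] := sY.
have iD : integrable_on T (fun s => u (X s) - u (Y s)).
  by have := integrableB _ iX iY; rewrite /integrable_on; apply.
apply/eqP; rewrite -subr_eq0 -normr_le0.
rewrite -(mul0r (expR (2 * C * t))) -(mulr0 2).
apply: (@gronwall _ T 0 C (M + N) _ (fun s => `|X s - Y s|) _ _ iD) => //.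
- move=> s sT; rewrite -(subrKA (f s)) (le_trans (ler_normD _ _))//.
  by rewrite lerD ?XM// distrC YN.
- move=> s sT; have st : (`[0, s] `<=` `[0, T])%classic.
    move: sT => /itvP sT r /=; rewrite !in_itv/= => /andP[-> /le_trans->]//.
    by rewrite sT.
  rewrite add0r XE// YE// opprD addrACA subrr addr0 -RintegralB//.
  + exact: integrableS iX.
  + exact: integrableS iY.
Qed.

(** * Truncation, a priori bound and existence under linear growth *)

Definition clamp (R : realType) (r x : R) : R := Num.max (- r) (Num.min r x).

Lemma clamp_id (R : realType) (r x : R) : `|x| <= r -> clamp r x = x.
Proof.
by rewrite ler_norml => /andP[rx xr]; rewrite /clamp (min_idPr xr) (max_idPr rx).
Qed.

Lemma norm_clamp_le (R : realType) (r x : R) : 0 <= r -> `|clamp r x| <= r.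
Proof.
move=> r0; rewrite /clamp ler_norml.
by case: (leP r x) => ?; [case: (leP (- r) r)|case: (leP (- r) x)] => *; lra.
Qed.

Lemma norm_clamp_le_norm (R : realType) (r x : R) : 0 <= r ->
  `|clamp r x| <= `|x|.
Proof.
move=> r0; have := ler_norm x; have := ler_norm (- x); rewrite normrN.
rewrite /clamp ler_norml.
by case: (leP r x) => ?; [case: (leP (- r) r)|case: (leP (- r) x)] => *; lra.
Qed.

Lemma clamp_lipschitz (R : realType) (r x y : R) : 0 <= r ->
  `|clamp r x - clamp r y| <= `|x - y|.
Proof.
move=> r0; have := ler_norm (x - y); have := ler_norm (y - x); rewrite distrC.
rewrite /clamp ler_norml.
by case: (leP r x) => ?; case: (leP r y) => ?;
  case: (leP (- r) r) => ?; try lra;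
  case: (leP (- r) x) => ?; case: (leP (- r) y) => *; lra.
Qed.

Lemma measurable_clamp (R : realType) (r : R) :
  measurable_fun [set: R] (clamp r).
Proof.
by apply: measurable_maxr => //; apply: measurable_minr.
Qed.

(** Gronwall's inequality for [1 + |X|]: adding 1 makes the growth condition homogeneous. The bound
    involves [u] only through [C], so it holds for the truncated coefficient as well. *)
Lemma linear_growth_solution_bound (R : realType) (T C K : R)
    (f u X : R -> R) (X0 : R) :
  0 < T -> 0 < C -> (forall x, `|u x| <= C * (1 + `|x|)) ->
  (forall t, t \in `[0, T] -> `|f t| <= K) ->
  is_solution T f u X0 X ->
  forall t, t \in `[0, T] -> `|X t| <= 2 * (1 + K) * expR (2 * C * T).
Proof.
move=> T0 C0 uC fK sX t tT.
have [_ iX /bounded_on_itvP[M XM]] := solution_admissible T0 sX.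
have [_ _ XE _] := sX.
have K0 : 0 <= K.
  by apply: (le_trans _ (fK 0 _)) => //; rewrite in_itv/= lexx ltW.
have Xt : 1 + `|X t| <= 2 * (1 + K) * expR (2 * C * t).
  apply: (@gronwall _ T (1 + K) C (1 + (M + K)) _ (fun s => 1 + `|X s|)
    T0 C0 iX _ _ _ _ tT) => s sT.
  - by rewrite lerD2l -(subrK (f s) (X s)) (le_trans (ler_normD _ _))// lerD
      ?XM ?fK.
  - exact: uC.
  - rewrite XE// -addrA lerD2l [leRHS]addrC (le_trans (ler_normD _ _))// lerD2l.
    exact: fK.
apply: (@le_trans _ _ (1 + `|X t|)); first by rewrite lerDr.
rewrite (le_trans Xt)// ler_wpM2l ?mulr_ge0 ?addr_ge0// ler_expR ler_wpM2l//.
  by rewrite mulr_ge0// ltW.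
by rewrite (itvP tT).
Qed.

Lemma locally_lipschitz_solution (R : realType) (T : R) (f u : R -> R) :
  0 < T -> measurable_fun (`[0, T] : set R) f -> measurable_fun [set: R] u ->
  condD2 T f u -> exists X, is_solution T f u (f 0) X.
Proof.
move=> T0 mf meas_u [[C [C0 uC]] uloc bf].
have [K fK] := (bounded_on_itvP _ _).1 bf.
pose r := 2 * (1 + K) * expR (2 * C * T).
have K0 : 0 <= K.
  by apply: (le_trans _ (fK 0 _)) => //; rewrite in_itv/= lexx ltW.
have r0 : 0 <= r by rewrite !mulr_ge0 ?addr_ge0 ?expR_ge0.
(* Local Lipschitz continuity is stated on open balls of positive radius, whereas truncated values
   may reach [r]; hence the radius [r + 1]. *)
have ltr1 x : `|clamp r x| < r + 1.
  by rewrite (le_lt_trans (norm_clamp_le _ r0))// ltrDl.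
have [L [L0 uL]] : exists L, 0 < L /\ forall x y : R,
    `|x| < r + 1 -> `|y| < r + 1 -> `|u x - u y| <= L * `|x - y|.
  by apply: uloc; rewrite ltr_wpDl.
have [X sX] : exists X, is_solution T f (u \o clamp r) (f 0) X.
  apply: lipschitz_solution => //.
    by apply: measurableT_comp => //; exact: measurable_clamp.
  split; last exact: bounded_integrable_on.
  exists L; split => // x y /=; rewrite (le_trans (uL _ _ (ltr1 _) (ltr1 _)))//.
  by rewrite ler_wpM2l ?clamp_lipschitz// ltW.
(* The truncated coefficient keeps the growth constant [C], so its solution never leaves [[-r, r]]
   and the truncation is inactive along it. *)
have Xr t : t \in `[0, T] -> `|X t| <= r.
  apply: (linear_growth_solution_bound T0 C0 _ fK sX) => x /=.
  by rewrite (le_trans (uC _))// ler_wpM2l ?lerD2l ?norm_clamp_le_norm// ltW.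
have uX t : t \in `[0, T] -> u (clamp r (X t)) = u (X t).
  by move=> tT; rewrite clamp_id ?Xr.
have [mX iX XE Xz] := sX; exists X; split => //.
- apply: (eq_integrable _ _ _ _ iX) => // t /set_mem tT /=.
  by rewrite uX.
- move=> t tT; rewrite XE//; congr (_ + _); apply: eq_Rintegral => s.
  rewrite inE/= in_itv/= => /andP[s0 st]; apply: uX; rewrite in_itv/= s0/=.
  by rewrite (le_trans st)// (itvP tT).
Qed.

(** * Existence, uniqueness and regularity combined *)

Theorem lemma10 (R : realType) (T : R) (hT : 0 < T) (f u : R -> R) (X0 : R)
    (hf : measurable_fun (`[0, T] : set R) f)
    (hu : measurable_fun [set: R] u)
    (hX0 : X0 = f 0)
    (hD : condD1 T f u \/ condD2 T f u) :
  exists X : R -> R,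
    [/\ is_solution T f u X0 X,
        forall Y : R -> R, is_solution T f u X0 Y ->
          forall t : R, t \in `[0, T] -> Y t = X t,
        condD1 T f u -> integrable_on T X
      & condD2 T f u -> bounded_on_itv T X].
Proof.
have [X sX] : exists X, is_solution T f u X0 X.
  by rewrite hX0; case: hD; [exact: lipschitz_solution|
    exact: locally_lipschitz_solution].
(* The construction of [X] is now forgotten: boundedness of [X - f] yields both regularity claims,
   whichever condition produced [X]. *)
have [mX _ bX] := solution_admissible hT sX.
exists X; split => //.
- move=> Y sY; case: hD => [[[C [C0 uC]] _]|[_ uloc bf]].
    by apply: (solution_unique_of_lipschitz hT C0 sY sX) => t _; exact: uC.
  have sol_bounded Z : is_solution T f u X0 Z -> exists M,
      forall t, t \in `[0, T] -> `|Z t| <= M.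
    move=> /(solution_admissible hT)[_ _ bZ].
    have /bounded_on_itvP[M ZM] := bounded_on_itvD bZ bf.
    by exists M => t tT; have := ZM _ tT; rewrite subrK.
  have [M XM] := sol_bounded X sX; have [N YN] := sol_bounded Y sY.
  have zT : 0 \in `[0, T] by rewrite in_itv/= lexx ltW.
  have M0 := le_trans (normr_ge0 _) (XM _ zT).
  have N0 := le_trans (normr_ge0 _) (YN _ zT).
  (* This radius is positive and strictly exceeds the bounds of both solutions. *)
  have [C [C0 uC]] : exists C, 0 < C /\ forall x y : R, `|x| < M + N + 1 ->
      `|y| < M + N + 1 -> `|u x - u y| <= C * `|x - y|.
    by apply: uloc; lra.
  apply: (solution_unique_of_lipschitz hT C0 sY sX) => t tT; apply: uC.
    by have := YN _ tT; lra.
  by have := XM _ tT; lra.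
- move=> [_ intf].
  have iXf : integrable_on T (fun t => X t - f t).
    by apply: bounded_integrable_on => //; exact: measurable_funB.
  have XE : EFin \o X = (EFin \o (fun t => X t - f t)) \+ (EFin \o f) :>
      (R -> \bar R).
    by apply/funext => t /=; rewrite -EFinD subrK.
  by rewrite /integrable_on XE; exact: integrableD.
- move=> [_ _ bf]; have := bounded_on_itvD bX bf.
  by under eq_fun do rewrite subrK.
Qed.
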